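(* Let $A$ be an algebra of Jordan type half over a field $\mathbb{F}$ of characteristic not $2$, let $a,b\in A$ be primitive axes of Jordan type half, and let $J=\langle\langle a,b\rangle\rangle$ be the subalgebra of $A$ generated by $a$ and $b$. If $(a,b)\notin\{0,\frac14,1\}$, then $J$ is solid; that is, every idempotent $c\in J$ with $c\neq 0$ and $c\neq 1_J$ is a primitive axis of Jordan type half in $A$.
   Context: All algebras are commutative but not necessarily associative. For an element $x$ of an algebra $A$ and $\lambda\in\mathbb{F}$ write $A_\lambda(x)=\{u\in A: xu=\lambda u\}$. A primitive axis of Jordan type half in $A$ is an element $x\neq 0$ with $x^2=x$, $A=A_1(x)\oplus A_0(x)\oplus A_{1/2}(x)$, $A_1(x)=\mathbb{F}x$, and satisfying the fusion rules $A_1(x)A_1(x)\subseteq A_1(x)$, $A_1(x)A_0(x)=0$, $A_0(x)A_0(x)\subseteq A_0(x)$, $A_1(x)A_{1/2}(x)\subseteq A_{1/2}(x)$, $A_0(x)A_{1/2}(x)\subseteq A_{1/2}(x)$, $A_{1/2}(x)A_{1/2}(x)\subseteq A_1(x)\oplus A_0(x)$. An algebra of Jordan type half is a commutative algebra generated by a set of primitive axes of Jordan type half. Every such algebra admits a unique bilinear form $(\cdot,\cdot)$ (the Frobenius form) satisfying $(uv,w)=(u,vw)$ for all $u,v,w$ and $(x,x)=1$ for every primitive axis $x$; $(a,b)$ denotes this form. A subalgebra $J=\langle\langle a,b\rangle\rangle$ generated by two primitive axes is called solid if every idempotent $c\in J$ with $c\neq 0$ and $c\neq 1_J$ (where $1_J$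 is the identity element of $J$, when $J$ has one) is a primitive axis of Jordan type half in $A$. (When $(a,b)\neq 1$, $J$ has an identity element.) *)

(* Defs.v *)
From mathcomp Require Import all_boot all_algebra.
Set Implicit Arguments. Unset Strict Implicit. Unset Printing Implicit Defensive.
Import GRing.Theory.
Local Open Scope ring_scope.

Section JordanTypeHalf.
Variables (F : fieldType) (A : lmodType F) (mul : A -> A -> A).

(* mul is commutative and bilinear (linearity in the first argument plus
   commutativity gives bilinearity). *)
Definition is_comm_algebra : Prop :=
  (forall u v, mul u v = mul v u) /\
  (forall (k : F) u v w, mul (k *: u + v) w = k *: mul u w + mul v w).

Definition eigsp (x : A) (l : F) (u : A) : Prop := mul x u = l *: u.

Definition half : F := (2%:R)^-1.

Definition fusion_rules (x : A) : Prop :=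
  forall u v,
  (eigsp x 1 u -> eigsp x 1 v -> eigsp x 1 (mul u v)) /\
  (eigsp x 1 u -> eigsp x 0 v -> mul u v = 0) /\
  (eigsp x 0 u -> eigsp x 0 v -> eigsp x 0 (mul u v)) /\
  (eigsp x 1 u -> eigsp x half v -> eigsp x half (mul u v)) /\
  (eigsp x 0 u -> eigsp x half v -> eigsp x half (mul u v)) /\
  (eigsp x half u -> eigsp x half v ->
     exists w1 w0, [/\ mul u v = w1 + w0, eigsp x 1 w1 & eigsp x 0 w0]).

Definition primitive_axis (x : A) : Prop :=
  [/\ x <> 0, mul x x = x,
      (forall u, exists u1 u0 uh,
          [/\ u = u1 + u0 + uh, eigsp x 1 u1, eigsp x 0 u0 & eigsp x half uh]),
      (forall u, eigsp x 1 u <-> exists k : F, u = k *: x) &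
      fusion_rules x].

Definition subalg_closed (P : A -> Prop) : Prop :=
  [/\ P 0,
      (forall (k : F) u v, P u -> P v -> P (k *: u + v)) &
      (forall u v, P u -> P v -> P (mul u v))].

Definition gen (S : A -> Prop) (u : A) : Prop :=
  forall P : A -> Prop, subalg_closed P -> (forall s, S s -> P s) -> P u.

Definition jordan_half_algebra : Prop :=
  is_comm_algebra /\
  exists X : A -> Prop, (forall x, X x -> primitive_axis x) /\ (forall u, gen X u).

Definition frobenius_form (f : A -> A -> F) : Prop :=
  [/\ (forall (k : F) u v w, f (k *: u + v) w = k * f u w + f v w),
      (forall (k : F) u v w, f u (k *: v + w) = k * f u v + f u w),
      (forall u v w, f (mul u v) w = f u (mul v w)) &
      (forall x, primitive_axis x -> f x x = 1)].

Definition solid (J : A -> Prop) : Prop :=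
  forall c, J c -> mul c c = c -> c <> 0 ->
    ~ (forall u, J u -> mul c u = u) -> primitive_axis c.

End JordanTypeHalf.

(* Main.v *)
Require Import Defs.
From mathcomp Require Import all_boot all_algebra.
From mathcomp Require Import ring.
Local Open Scope ring_scope.
Import GRing.Theory.

(* A nonzero idempotent c is a primitive axis of Jordan type half exactly when
   (c, c) = 1 and, for all u and v,
     2 c(cu) = cu + (c,u) c,
     4 (cu)(cv) = (cu)v + u(cv) - c(uv) + (c,u) cv + (c,v) cu + (c,uv) c.
   The second identity says that the Miyamoto map u |-> u - 4 cu + 4 (c,u) c is
   multiplicative. Both identities are quadratic in c.
   If (a,b) is neither 0 nor 1, then J has basis e = 1_J, s = a - e/2,
   t = b - e/2, and its idempotents other than 0 and e are the points
   e/2 + p s + q t of the conic p^2 + q^2 + 2 m p q = 1, with m = 2 (a,b) - 1.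
   A quadratic function on this conic that vanishes at five points is zero, and
   the images of a and b under Miyamoto involutions provide five axes on the
   conic unless m = 1, m = -1/2 or m = 0, that is, (a,b) = 1, 1/4 or 1/2.
   For m = 0 only the four axes e/2 +- s and e/2 +- t are available; what
   remains is the vanishing of the (p q)-coefficient of both identities, and it
   follows from the relations found among the other coefficients. *)

(** * Linear identities in a module, by reflection *)

Section LinearExpressions.
Context {F : fieldType} {A : lmodType F}.

(* Formal linear combinations, for deciding equalities in a module by comparing
   the coefficients of the atoms. *)
Inductive lexp : Type :=
| LZero
| LVar of nat
| LAdd of lexp & lexp
| LOpp of lexp
| LScale of F & lexp.

Fixpoint leval (env : seq A) (e : lexp) : A :=
  match e with
  | LZero => 0
  | LVar i => nth 0 env i
  | LAdd e1 e2 => leval env e1 + leval env e2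
  | LOpp e1 => - leval env e1
  | LScale k e1 => k *: leval env e1
  end.

Fixpoint lcoef (e : lexp) (i : nat) : F :=
  match e with
  | LZero => 0
  | LVar j => if eqn j i then 1 else 0
  | LAdd e1 e2 => lcoef e1 i + lcoef e2 i
  | LOpp e1 => - lcoef e1 i
  | LScale k e1 => k * lcoef e1 i
  end.

Fixpoint same_coefs (n : nat) (e1 e2 : lexp) : Prop :=
  match n with
  | 0 => True
  | n'.+1 => lcoef e1 n' = lcoef e2 n' /\ same_coefs n' e1 e2
  end.

Lemma leval_coefs env e :
  leval env e = \sum_(i < size env) lcoef e i *: nth 0 env i.
Proof.
elim: e => [|j|e1 IH1 e2 IH2|e1 IH1|k e1 IH1] /=.
- by rewrite big1 // => i _; rewrite scale0r.
- have [lt_j|le_j] := ltnP j (size env); last first.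
    (* An index past the end of [env] evaluates to the default 0, and no summand carries it. *)
    rewrite nth_default // big1 // => i _.
    case: eqnP => [ji|_]; last by rewrite scale0r.
    by move: (ltn_ord i); rewrite -ji ltnNge le_j.
  rewrite (bigD1 (Ordinal lt_j)) //= big1 ?addr0; last first.
    move=> i ne_ij; case: eqnP => [ji|_]; last by rewrite scale0r.
    by case/eqP: ne_ij; apply: val_inj.
  by case: eqnP => // _; rewrite scale1r.
- by rewrite IH1 IH2 -big_split /=; apply: eq_bigr => i _; rewrite scalerDl.
- by rewrite IH1 -sumrN; apply: eq_bigr => i _; rewrite scaleNr.
- by rewrite IH1 scaler_sumr; apply: eq_bigr => i _; rewrite scalerA.
Qed.

Lemma leval_eq env e1 e2 :
  same_coefs (size env) e1 e2 -> leval env e1 = leval env e2.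
Proof.
move=> h; rewrite !leval_coefs; apply: eq_bigr => i _; congr (_ *: _).
case: i => i /=; elim: (size env) h => // n IH [hn /IH{}IH].
by rewrite ltnS leq_eqVlt => /orP[/eqP->|/IH].
Qed.

End LinearExpressions.

Ltac atom_index x l :=
  lazymatch l with
  | x :: _ => constr:(0%N)
  | _ :: ?l' => let i := atom_index x l' in constr:(i.+1)
  end.

Ltac add_atom x l :=
  let rec mem l0 :=
    lazymatch l0 with
    | nil => constr:(x :: l)
    | x :: _ => l
    | _ :: ?l1 => mem l1
    end
  in mem l.

Ltac atoms u l :=
  lazymatch u with
  | 0 => l
  | ?v + ?w => let l' := atoms v l in atoms w l'
  | - ?v => atoms v l
  | _ *: ?v => atoms v l
  | _ => add_atom u l
  end.

Ltac reify F u l :=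
  lazymatch u with
  | 0 => constr:(@LZero F)
  | ?v + ?w => let e1 := reify F v l in let e2 := reify F w l in
               constr:(LAdd e1 e2)
  | - ?v => let e1 := reify F v l in constr:(LOpp e1)
  | ?k *: ?v => let e1 := reify F v l in constr:(LScale k e1)
  | _ => let i := atom_index u l in constr:(@LVar F i)
  end.

Ltac lin_coefs :=
  match goal with
  | F : GRing.Field.type, A : GRing.Lmodule.type _ |- ?u = ?v =>
    let l := atoms u (@nil A) in
    let l := atoms v l in
    let e1 := reify F u l in
    let e2 := reify F v l in
    change (@leval F A l e1 = @leval F A l e2); apply: leval_eq;
    cbn [same_coefs size lcoef eqn]
  end.

(** The nonvanishing conditions left by [field] are closed from the context, by facts such as
    [two_neq0] and [four_neq0]. *)
Ltac scalar_field := solve [field; do ?[apply/andP; split]; done].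

Ltac lin := lin_coefs; do ?[apply: conj | exact: I]; scalar_field.

(** Turns a goal into a certificate: once the coefficient of the hypothesis is given, a formal
    identity remains for [lin]. *)
Lemma eq_lincomb1 {F : fieldType} {A : lmodType F} (k : F) {l r u v : A} :
  l = r -> u - v = k *: (l - r) -> u = v.
Proof. by move=> -> /eqP; rewrite subrr scaler0 subr_eq0 => /eqP. Qed.

Lemma eq_lincomb2 {F : fieldType} {A : lmodType F} (k1 k2 : F)
    {l1 r1 l2 r2 u v : A} :
  l1 = r1 -> l2 = r2 -> u - v = k1 *: (l1 - r1) + k2 *: (l2 - r2) -> u = v.
Proof.
by move=> -> -> /eqP; rewrite !subrr !scaler0 addr0 subr_eq0 => /eqP.
Qed.

Lemma scaler_inj0 {F : fieldType} {A : lmodType F} {k : F} {u v : A} :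
  k != 0 -> k *: (u - v) = 0 -> u = v.
Proof.
by move=> k0 /eqP; rewrite scaler_eq0 (negPf k0) subr_eq0 => /eqP.
Qed.

(** * Vector-valued quadratic functions on a conic *)

Section ConicInterpolation.
Context {F : fieldType} {A : lmodType F} (two_neq0 : (2%:R : F) != 0).
Context (m : F) (R0 R1 R2 R11 R12 R22 : A).

Definition quad (p q : F) : A :=
  R0 + p *: R1 + q *: R2 + p ^+ 2 *: R11 + (p * q) *: R12 + q ^+ 2 *: R22.

Lemma quad_four_points :
  m != 1 -> 2%:R * m + 1 != 0 ->
  quad 1 0 = 0 -> quad 0 1 = 0 -> quad (2%:R * m) (- 1) = 0 ->
  quad (- 1) (2%:R * m) = 0 ->
  [/\ R1 = - (R0 + R11), R2 = - (R0 + R11), R22 = R11 &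
      (1 - m) *: (R0 + R11) = m *: (R12 - (2%:R * m) *: R11)].
Proof.
rewrite /quad => m1 m2 h1 h2 h3 h4.
have R22E : R22 = R11.
  (* The combination (h3 - h4) - (2m + 1)(h1 - h2) is antisymmetric in p and q; [R1 - R2] cancels
     and this multiple of [R11 - R22] is left. *)
  apply: (@scaler_inj0 _ _ (2%:R * (2%:R * m + 1) * (m - 1))).
    by rewrite !mulf_neq0 // subr_eq0.
  apply: (eq_lincomb2 (2%:R * m + 1) (- (2%:R * m + 1)) h1 h2).
  apply: (eq_lincomb2 (- 1) 1 h3 h4).
  lin.
have R1E : R1 = - (R0 + R11).
  by apply: (eq_lincomb1 1 h1); lin.
have R2E : R2 = - (R0 + R11).
  by apply: (eq_lincomb1 1 h2); rewrite R22E; lin.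
split=> //.
apply: (eq_lincomb1 (2%:R^-1) h3); rewrite R22E R1E R2E; lin.
Qed.

(** The conic equation absorbs p^2 + q^2, so after the relations of [quad_four_points] only two
    vectors remain free. *)
Lemma quad_conic p q :
  R1 = - (R0 + R11) -> R2 = - (R0 + R11) -> R22 = R11 ->
  p ^+ 2 + q ^+ 2 + 2%:R * m * p * q = 1 ->
  quad p q = (1 - p - q) *: (R0 + R11)
             + (p * q) *: (R12 - (2%:R * m) *: R11).
Proof.
move=> R1E R2E R22E pq1; rewrite /quad R22E R1E R2E.
have q2 : q ^+ 2 = 1 - (p ^+ 2 + 2%:R * m * p * q).
  by apply/eqP; rewrite eq_sym subr_eq -[eqbLHS]pq1; apply/eqP; ring.
rewrite q2; lin.
Qed.

Lemma quad_five_points p q :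
  m != 0 -> m != 1 -> 2%:R * m + 1 != 0 ->
  quad 1 0 = 0 -> quad 0 1 = 0 -> quad (2%:R * m) (- 1) = 0 ->
  quad (- 1) (2%:R * m) = 0 -> quad (- (2%:R * m)) (4%:R * m ^+ 2 - 1) = 0 ->
  p ^+ 2 + q ^+ 2 + 2%:R * m * p * q = 1 -> quad p q = 0.
Proof.
move=> m0 m1 m2 h1 h2 h3 h4 + pq1.
have [R1E R2E R22E XY] := quad_four_points m1 m2 h1 h2 h3 h4.
rewrite !quad_conic //; last by ring.
set X := R0 + R11 in XY *; set Y := R12 - _ in XY *; move=> h5.
have Y0 : Y = 0.
  (* At the fifth point 1 - p - q = 2(1 - m)(2m + 1); eliminating (1 - m)X = mY leaves this multiple
     of Y. Here m != 0 enters. *)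
  apply: (@scaler_inj0 _ _ (2%:R * 2%:R * (2%:R * m + 1) * m * (1 - m))).
    by rewrite !mulf_neq0 // subr_eq0 eq_sym.
  by apply: (eq_lincomb2 1 (- 2%:R * (2%:R * m + 1)) h5 XY); lin.
have X0 : X = 0.
  apply: (@scaler_inj0 _ _ (1 - m)); first by rewrite subr_eq0 eq_sym.
  by rewrite subr0 XY Y0 scaler0.
by rewrite X0 Y0 !scaler0 addr0.
Qed.

End ConicInterpolation.

(** * Bilinear calculus for the product and the form *)

Section FrobeniusAlgebra.
Context {F : fieldType} {A : lmodType F} {mul : A -> A -> A} {f : A -> A -> F}.
Context (two_neq0 : (2%:R : F) != 0) (algA : is_comm_algebra mul)
  (frobf : frobenius_form mul f).

Let four_neq0 : (4%:R : F) != 0.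
Proof. by rewrite (natrM F 2 2) mulf_neq0. Qed.

Lemma alg_mulC u v : mul u v = mul v u. Proof. by case: algA. Qed.

Lemma alg_mulDl u v w : mul (u + v) w = mul u w + mul v w.
Proof. by have [_ h] := algA; have := h 1 u v w; rewrite !scale1r. Qed.

Lemma alg_mul0l u : mul 0 u = 0.
Proof. by apply: (addrI (mul 0 u)); rewrite -alg_mulDl !addr0. Qed.

Lemma alg_mulZl k u v : mul (k *: u) v = k *: mul u v.
Proof.
by have [_ h] := algA; have := h k u 0 v; rewrite addr0 alg_mul0l addr0.
Qed.

Lemma alg_mulNl u v : mul (- u) v = - mul u v.
Proof. by rewrite -scaleN1r alg_mulZl scaleN1r. Qed.

Lemma alg_mulDr u v w : mul w (u + v) = mul w u + mul w v.
Proof. by rewrite !(alg_mulC w) alg_mulDl. Qed.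

Lemma alg_mul0r u : mul u 0 = 0.
Proof. by rewrite alg_mulC alg_mul0l. Qed.

Lemma alg_mulZr k u v : mul u (k *: v) = k *: mul u v.
Proof. by rewrite !(alg_mulC u) alg_mulZl. Qed.

Lemma alg_mulNr u v : mul u (- v) = - mul u v.
Proof. by rewrite !(alg_mulC u) alg_mulNl. Qed.

Definition alg_mulE := (alg_mulDl, alg_mulDr, alg_mulZl, alg_mulZr,
  alg_mulNl, alg_mulNr, alg_mul0l, alg_mul0r).

Lemma formDl u v w : f (u + v) w = f u w + f v w.
Proof.
by have [h _ _ _] := frobf; have := h 1 u v w; rewrite scale1r mul1r.
Qed.

Lemma formDr u v w : f w (u + v) = f w u + f w v.
Proof.
by have [_ h _ _] := frobf; have := h 1 w u v; rewrite scale1r mul1r.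
Qed.

Lemma form0l u : f 0 u = 0.
Proof. by apply: (addrI (f 0 u)); rewrite -formDl !addr0. Qed.

Lemma form0r u : f u 0 = 0.
Proof. by apply: (addrI (f u 0)); rewrite -formDr !addr0. Qed.

Lemma formZl k u v : f (k *: u) v = k * f u v.
Proof.
by have [h _ _ _] := frobf; have := h k u 0 v; rewrite addr0 form0l addr0.
Qed.

Lemma formZr k u v : f u (k *: v) = k * f u v.
Proof.
by have [_ h _ _] := frobf; have := h k u v 0; rewrite addr0 form0r addr0.
Qed.

Lemma formNl u v : f (- u) v = - f u v.
Proof. by rewrite -scaleN1r formZl mulN1r. Qed.

Lemma formNr u v : f u (- v) = - f u v.
Proof. by rewrite -scaleN1r formZr mulN1r. Qed.

Definition formE := (formDl, formDr, formZl, formZr, formNl, formNr,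
  form0l, form0r).

Lemma form_assoc u v w : f (mul u v) w = f u (mul v w).
Proof. by case: frobf. Qed.

(** Symmetry is not an axiom of [frobenius_form]; associativity and commutativity give it when one
    argument is a product, for instance an idempotent. *)
Lemma form_mulC u v w : f (mul u v) w = f w (mul u v).
Proof.
by rewrite form_assoc (alg_mulC v) -form_assoc alg_mulC form_assoc alg_mulC
  -form_assoc alg_mulC form_assoc.
Qed.

(** * Primitive axes characterised by two polynomial identities *)

(** With L the multiplication by c, vanishing says that L(2L - 1) is the map u |-> (c,u) c. This
    packs the eigenspace decomposition and primitivity into one identity. *)
Definition peirce_defect (c u : A) : A :=
  2%:R *: mul c (mul c u) - mul c u - f c u *: c.

Definition fusion_defect (c u v : A) : A :=
  4%:R *: mul (mul c u) (mul c v) - mul (mul c u) v - mul u (mul c v)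
  + mul c (mul u v) - f c u *: mul c v - f c v *: mul c u
  - f c (mul u v) *: c.

Definition axial_idempotent (c : A) : Prop :=
  [/\ mul c c = c, f c c = 1, (forall u, peirce_defect c u = 0) &
      (forall u v, fusion_defect c u v = 0)].

Lemma fusion_defectC c u v : fusion_defect c u v = fusion_defect c v u.
Proof.
rewrite /fusion_defect (alg_mulC u v) (alg_mulC (mul c u)) (alg_mulC u).
by rewrite (alg_mulC (mul c u)); lin.
Qed.

Lemma fusion_defectDl c u v w :
  fusion_defect c (u + v) w = fusion_defect c u w + fusion_defect c v w.
Proof. by rewrite /fusion_defect !alg_mulE !formE; lin. Qed.

Lemma fusion_defectZl c k u w :
  fusion_defect c (k *: u) w = k *: fusion_defect c u w.
Proof. by rewrite /fusion_defect !alg_mulE !formE; lin. Qed.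

Lemma fusion_defectDr c u v w :
  fusion_defect c w (u + v) = fusion_defect c w u + fusion_defect c w v.
Proof. by rewrite !(fusion_defectC _ w) fusion_defectDl. Qed.

(** Here the second defect is twice the first, so only the 0- and half-eigenvectors remain to be
    tested against the second identity. *)
Lemma fusion_defect_self c u :
  mul c c = c -> f c c = 1 -> peirce_defect c u = 0 -> fusion_defect c c u = 0.
Proof.
move=> cc fcc P; rewrite /fusion_defect -form_assoc !cc fcc.
by apply: (eq_lincomb1 2%:R P); rewrite /peirce_defect; lin.
Qed.

(** Both defects are linear in u and v, hence may be checked on eigenvectors. Associativity of the
    form makes x orthogonal to its 0- and half-eigenspaces. *)
Lemma axial_of_primitive {x} : primitive_axis mul x -> axial_idempotent x.
Proof.
move=> px; have [_ _ _ f_axis] := frobf; have fxx := f_axis x px.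
have [_ xx dec prim fus] := px.
have half2 : 2%:R * Defs.half F = 1 by rewrite /Defs.half divff.
have f0 u : eigsp mul x 0 u -> f x u = 0.
  by move=> xu; rewrite -{1}xx form_assoc xu scale0r form0r.
have fh u : eigsp mul x (Defs.half F) u -> f x u = 0.
  move=> xu; have : f x u = Defs.half F * f x u.
    by rewrite -{1}xx form_assoc xu formZr.
  move/(congr1 (fun z => 2%:R * z)); rewrite mulrA half2 mul1r => h.
  have : (2%:R - 1) * f x u = 0 by rewrite mulrBl mul1r h subrr.
  by rewrite (_ : 2%:R - 1 = 1) ?mul1r //; ring.
have P u : peirce_defect x u = 0.
  have [_ [u0 [uh [-> /prim [k ->] e0 eh]]]] := dec u.
  rewrite /peirce_defect !formE (f0 _ e0) (fh _ eh) fxx.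
  by rewrite !(alg_mulE, xx, e0, eh, scale0r, scaler0) /Defs.half; lin.
split=> // u v.
have F00 u0 v0 : eigsp mul x 0 u0 -> eigsp mul x 0 v0 ->
    fusion_defect x u0 v0 = 0.
  move=> e0 e0'; have [_ [_ [/(_ e0 e0') e00 _]]] := fus u0 v0.
  rewrite /fusion_defect (f0 _ e0) (f0 _ e0') (f0 _ e00) e00 e0 e0'.
  by rewrite !(scale0r, alg_mulE); lin.
have F0h u0 vh : eigsp mul x 0 u0 -> eigsp mul x (Defs.half F) vh ->
    fusion_defect x u0 vh = 0.
  move=> e0 eh; have [_ [_ [_ [_ [/(_ e0 eh) e0h _]]]]] := fus u0 vh.
  rewrite /fusion_defect (f0 _ e0) (fh _ eh) (fh _ e0h) e0h e0 eh.
  by rewrite !(scale0r, alg_mulE); lin.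
have Fhh uh vh : eigsp mul x (Defs.half F) uh -> eigsp mul x (Defs.half F) vh ->
    fusion_defect x uh vh = 0.
  move=> eh eh'; have [_ [_ [_ [_ [_ /(_ eh eh')]]]]] := fus uh vh.
  case=> w1 [w0 [uvE /prim [k w1E] e0]].
  rewrite /fusion_defect (fh _ eh) (fh _ eh') eh eh' !alg_mulE uvE w1E.
  rewrite !(alg_mulE, formE) xx e0 fxx (f0 _ e0) !scale0r /Defs.half.
  lin.
have [_ [u0 [uh [-> /prim [k ->] e0 eh]]]] := dec u.
have [_ [v0 [vh [-> /prim [l ->] e0' eh']]]] := dec v.
have Fx w : fusion_defect x x w = 0 by apply: fusion_defect_self.
rewrite !(fusion_defectDl, fusion_defectDr, fusion_defectZl).
rewrite ![fusion_defect x _ (_ *: _)]fusion_defectC !fusion_defectZl !Fx.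
rewrite (F00 u0 v0) ?(F0h u0 vh) ?(Fhh uh vh) //.
rewrite ?(fusion_defectC x uh v0) ?(F0h v0 uh) //.
by rewrite !scaler0 !addr0.
Qed.

Lemma primitive_of_axial c :
  axial_idempotent c -> primitive_axis mul c.
Proof.
move=> [cc fcc P G].
have c0 : c != 0.
  by apply/eqP => c0; move/eqP: fcc; rewrite c0 form0l eq_sym oner_eq0.
have cc2 u : mul c (mul c u) = Defs.half F *: (mul c u + f c u *: c).
  apply: (eq_lincomb1 (Defs.half F) (P u)).
  by rewrite /peirce_defect /Defs.half; lin.
have f0 u : eigsp mul c 0 u -> f c u = 0.
  by move=> cu; rewrite -{1}cc form_assoc cu scale0r form0r.
have prim u : eigsp mul c 1 u -> u = f c u *: c.
  rewrite /eigsp scale1r => cu; have := P u; rewrite /peirce_defect !cu => h.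
  by apply: (eq_lincomb1 1 h); lin.
have fh u : eigsp mul c (Defs.half F) u -> f c u = 0.
  rewrite /eigsp => cu; have := P u; rewrite /peirce_defect !(cu, alg_mulE).
  move=> h; have : - f c u *: c = 0.
    by apply: (eq_lincomb1 1 h); rewrite /Defs.half; lin.
  by move/eqP; rewrite scaler_eq0 (negPf c0) orbF oppr_eq0 => /eqP.
split=> //.
- exact/eqP.
(* The components solve u = u1 + u0 + uh and cu = u1 + uh/2 with u1 = (c,u) c. *)
- move=> u; exists (f c u *: c).
  exists (u + f c u *: c - 2%:R *: mul c u), (2%:R *: (mul c u - f c u *: c)).
  split; rewrite /eigsp ?(alg_mulE, cc, cc2) /Defs.half; lin.
- move=> u; split=> [/prim ->|[k ->]]; first by exists (f c u).
  by rewrite /eigsp alg_mulE cc scale1r.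
move=> u v; do 5?split.
- by move=> /prim -> /prim ->; rewrite /eigsp !alg_mulE !cc; lin.
- by move=> /prim -> cv; rewrite !alg_mulE cv scale0r scaler0.
- move=> cu cv; have := G u v; rewrite /fusion_defect -(form_assoc c u) cu cv.
  rewrite !(scale0r, alg_mulE, form0l, f0 _ cu, f0 _ cv) /eigsp => h.
  by apply: (eq_lincomb1 1 h); lin.
- by move=> /prim -> cv; rewrite /eigsp !alg_mulE cv !alg_mulE cv; lin.
- move=> cu cv; have := G u v; rewrite /fusion_defect -(form_assoc c u) cu cv.
  rewrite !(scale0r, alg_mulE, form0l, f0 _ cu, fh _ cv) /eigsp => h.
  by apply: (eq_lincomb1 1 h); rewrite /Defs.half; lin.
(* On half-eigenvectors the second identity reduces to c(uv) = (c,uv) c, so the second witness is a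
   0-eigenvector. *)
move=> cu cv; exists (f c (mul u v) *: c), (mul u v - f c (mul u v) *: c).
have := G u v; rewrite /fusion_defect cu cv.
rewrite !(scale0r, alg_mulE, fh _ cu, fh _ cv) /eigsp => h.
split; first by lin.
  by rewrite !alg_mulE cc; lin.
by rewrite !alg_mulE cc; apply: (eq_lincomb1 1 h); rewrite /Defs.half; lin.
Qed.

(** * Miyamoto involutions *)

(** For a primitive axis a this is 1 on the 1- and 0-eigenspaces and -1 on the half-eigenspace. *)
Definition miyamoto (a u : A) : A := u - 4%:R *: mul a u + (4%:R * f a u) *: a.

Lemma miyamotoB a u v : miyamoto a (u - v) = miyamoto a u - miyamoto a v.
Proof. by rewrite /miyamoto !alg_mulE !formE; lin. Qed.

Lemma miyamotoD a u v : miyamoto a (u + v) = miyamoto a u + miyamoto a v.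
Proof. by rewrite /miyamoto !alg_mulE !formE; lin. Qed.

Lemma miyamotoZ a k u : miyamoto a (k *: u) = k *: miyamoto a u.
Proof. by rewrite /miyamoto !alg_mulE !formE; lin. Qed.

Lemma miyamoto0 a : miyamoto a 0 = 0.
Proof. by rewrite -[X in miyamoto a X](subrr 0) miyamotoB subrr. Qed.

Lemma axial_fC {a} u : axial_idempotent a -> f u a = f a u.
Proof. by case=> aa _ _ _; rewrite -aa form_mulC. Qed.

Lemma axial_f_mul {a} u : axial_idempotent a -> f a (mul a u) = f a u.
Proof. by case=> aa _ _ _; rewrite -form_assoc aa. Qed.

(** With G and P the second and first defects of a, the two sides differ by -4 G(u,v) + 8 (a,u) P(v)
    + 8 (a,v) P(u). *)
Lemma miyamotoM {a} u v : axial_idempotent a ->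
  miyamoto a (mul u v) = mul (miyamoto a u) (miyamoto a v).
Proof.
move=> [aa _ P G]; apply: (eq_lincomb2 (- 4%:R) (8%:R * f a u) (G u v) (P v)).
apply: (eq_lincomb1 (8%:R * f a v) (P u)).
rewrite /miyamoto /fusion_defect /peirce_defect !alg_mulE aa.
by rewrite !(alg_mulC _ a); lin.
Qed.

Lemma miyamotoK {a} : axial_idempotent a -> involutive (miyamoto a).
Proof.
move=> axa u; have [aa faa P _] := axa.
apply: (eq_lincomb1 8%:R (P u)).
rewrite /miyamoto /peirce_defect !formE (axial_f_mul u axa) faa !alg_mulE aa.
lin.
Qed.

Lemma miyamoto_isometry a u v : axial_idempotent a ->
  f (miyamoto a u) (miyamoto a v) = f u v.
Proof.
move=> axa; have adj w : f (miyamoto a u) w = f u (miyamoto a w).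
  by rewrite /miyamoto !formE (alg_mulC a u) form_assoc (axial_fC u axa); ring.
by rewrite adj miyamotoK.
Qed.

(** The Miyamoto map is an isometric automorphism. Being an involution, it is onto, so each defect
    of the image of b is the image of a defect of b. *)
Lemma axial_miyamoto a b :
  axial_idempotent a -> axial_idempotent b -> axial_idempotent (miyamoto a b).
Proof.
move=> axa [bb fbb P G]; have tK := miyamotoK axa.
have tM u v : mul (miyamoto a u) (miyamoto a v) = miyamoto a (mul u v).
  by rewrite (miyamotoM u v axa).
split.
- by rewrite tM bb.
- by rewrite miyamoto_isometry.
- move=> u; rewrite -[u]tK; move: (miyamoto a u) => {}u.
  rewrite /peirce_defect !tM miyamoto_isometry // -!miyamotoZ -!miyamotoB.
  by rewrite [X in miyamoto a X]P miyamoto0.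
move=> u v; rewrite -[u]tK -[v]tK.
move: (miyamoto a u) (miyamoto a v) => {}u {}v.
rewrite /fusion_defect !tM !miyamoto_isometry // -!miyamotoZ.
by rewrite -!(miyamotoB, miyamotoD) [X in miyamoto a X]G miyamoto0.
Qed.

(** * The subalgebra generated by two axes, as a spin factor *)

(** For v, w in the plane of s and t the product is vw = ((v,w)/2) e; thus e/2 + v is idempotent as
    soon as (v,v) = 1/2. *)
Record circle_frame (m : F) (e s t : A) : Prop := CircleFrame {
  frame_ee : mul e e = e;
  frame_es : mul e s = s;
  frame_et : mul e t = t;
  frame_ss : mul s s = 4%:R^-1 *: e;
  frame_tt : mul t t = 4%:R^-1 *: e;
  frame_st : mul s t = (m / 4%:R) *: e;
  frame_fee : f e e = 2%:R;
  frame_fes : f e s = 0;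
  frame_fet : f e t = 0;
  frame_fss : f s s = 2%:R^-1;
  frame_ftt : f t t = 2%:R^-1;
  frame_fst : f s t = m / 2%:R }.

Lemma frame_sym {m e s t} : circle_frame m e s t -> circle_frame m e t s.
Proof.
case=> ee es et ss tt st fee fes fet fss ftt fst; split=> //.
  by rewrite alg_mulC.
by rewrite -es -form_mulC es.
Qed.

(** The element g = ab - (a + b)/2 acts on J as the scalar r = ((a,b) - 1)/2, and e = g/r. The first
    identity gives ag = ra and bg = rb; the second identity of a at (b,g) gives g(ab) = r ab, whence
    gg = rg. *)
Lemma circle_frame_axes {a b} : f a b != 1 ->
  axial_idempotent a -> axial_idempotent b ->
  exists e, circle_frame (2%:R * f a b - 1) e (a - 2%:R^-1 *: e)
                                              (b - 2%:R^-1 *: e).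
Proof.
move=> ab1 axa axb; have [aa faa Pa Ga] := axa; have [bb fbb Pb _] := axb.
set k := f a b in ab1 *.
have fba : f b a = k by rewrite axial_fC.
pose r := (k - 1) / 2%:R.
have r0 : r != 0 by rewrite mulf_neq0 ?invr_neq0 // subr_eq0.
(* Introduced opaquely: alg_mulE would see through a local definition. *)
have [g gdef] : exists g, g = mul a b - 2%:R^-1 *: (a + b) by eexists.
have ag : mul a g = r *: a.
  rewrite gdef !alg_mulE aa.
  by apply: (eq_lincomb1 2%:R^-1 (Pa b)); rewrite /peirce_defect -/k /r; lin.
have bg : mul b g = r *: b.
  rewrite gdef !alg_mulE bb (alg_mulC a).
  apply: (eq_lincomb1 2%:R^-1 (Pb a)); rewrite /peirce_defect fba /r.
  by rewrite (alg_mulC b a); lin.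
have fag : f a g = r.
  by rewrite gdef !formE axial_f_mul // faa -/k /r; field.
have fbg : f b g = r.
  by rewrite gdef !formE alg_mulC axial_f_mul // fbb fba /r; field.
have gab : mul g (mul a b) = r *: mul a b.
  have ba := alg_mulC b a.
  have := Ga b g; rewrite /fusion_defect ag bg !alg_mulE fag -/k ba formZr -/k.
  rewrite (alg_mulC _ g) (alg_mulC _ a) => h.
  apply: (eq_lincomb2 (- 1) (2%:R * r) h (Pa b)).
  by rewrite /peirce_defect -/k; lin.
have gg : mul g g = r *: g.
  rewrite {2}gdef !alg_mulE gab (alg_mulC g a) (alg_mulC g b) ag bg gdef.
  by lin.
have fgg : f g g = 2%:R * r ^+ 2.
  have -> : f g g = f a (mul b g) - 2%:R^-1 * (f a g + f b g).
    by rewrite {1}gdef !formE form_assoc.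
  by rewrite bg formZr fag fbg -/k /r; field.
have [e edef] : exists e, e = r^-1 *: g by eexists.
have ge : g = r *: e by rewrite edef scalerA mulfV ?scale1r.
have ae : mul a e = a by rewrite edef alg_mulE ag scalerA mulVf ?scale1r.
have be : mul b e = b by rewrite edef alg_mulE bg scalerA mulVf ?scale1r.
have ee : mul e e = e.
  by rewrite edef alg_mulZl alg_mulZr gg !scalerA -mulrA mulVf // mulr1.
have fae : f a e = 1 by rewrite edef formZr fag mulVf.
have fbe : f b e = 1 by rewrite edef formZr fbg mulVf.
have fee : f e e = 2%:R.
  by rewrite edef formZl formZr fgg; field.
have fea : f e a = 1 by rewrite axial_fC.
have feb : f e b = 1 by rewrite axial_fC.
have abE : mul a b = r *: e + 2%:R^-1 *: (a + b) by rewrite -ge gdef; lin.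
exists e.
split; rewrite ?(alg_mulE, formE) ?(alg_mulC e a) ?(alg_mulC e b) ?ae ?be ?ee
  ?aa ?bb ?abE ?fee ?fae ?fbe ?fea ?feb ?faa ?fbb -/k /r;
  solve [lin | scalar_field].
Qed.

(** The vector 2ms - t is the reflection of t that fixes s. The parameter m is preserved, so
    reflections can be iterated. *)
Lemma frame_coords {m e s t} : circle_frame m e s t ->
  circle_frame m e ((2%:R * m) *: s - t) s.
Proof.
case=> ee es et ss tt st fee fes fet fss ftt fst.
have fts : f t s = m / 2%:R by rewrite -es -form_mulC es.
by split; rewrite ?(alg_mulE, formE) ?(alg_mulC t s) ?ee ?es ?et ?ss ?tt ?st
  ?fee ?fes ?fet ?fss ?ftt ?fst ?fts; solve [lin | scalar_field].
Qed.

Lemma frame_reflect {m e s t} : circle_frame m e s t ->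
  miyamoto (2%:R^-1 *: e + s) (2%:R^-1 *: e + t) =
    2%:R^-1 *: e + ((2%:R * m) *: s - t).
Proof.
case=> ee es et ss tt st fee fes fet fss ftt fst.
have fse : f s e = 0 by rewrite -es form_mulC es.
rewrite /miyamoto !alg_mulE !formE (alg_mulC s e).
by rewrite ee es et st fee fet fse fst; lin.
Qed.

(** * The two defects as quadratic functions on the conic *)

(** The quadratic part of the first defect, split into two slots without symmetrising: the defect is
    [peirce_polar u c c - mul c u]. Likewise the second defect is [fusion_polar u v c c +
    fusion_linear u v c]. *)
Definition peirce_polar (u c d : A) : A :=
  2%:R *: mul c (mul d u) - f c u *: d.

Definition fusion_polar (u v c d : A) : A :=
  4%:R *: mul (mul c u) (mul d v) - f c u *: mul d v - f c v *: mul d u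
  - f c (mul u v) *: d.

Definition fusion_linear (u v c : A) : A :=
  mul c (mul u v) - mul (mul c u) v - mul u (mul c v).

Lemma peirce_defect_quad o s t u p q :
  peirce_defect (o + (p *: s + q *: t)) u =
  quad (peirce_defect o u)
    (peirce_polar u o s + peirce_polar u s o - mul s u)
    (peirce_polar u o t + peirce_polar u t o - mul t u)
    (peirce_polar u s s) (peirce_polar u s t + peirce_polar u t s)
    (peirce_polar u t t) p q.
Proof.
by rewrite /quad /peirce_defect /peirce_polar !(alg_mulE, formE); lin.
Qed.

Lemma fusion_defect_quad o s t u v p q :
  fusion_defect (o + (p *: s + q *: t)) u v =
  quad (fusion_defect o u v)
    (fusion_polar u v o s + fusion_polar u v s o + fusion_linear u v s)
    (fusion_polar u v o t + fusion_polar u v t o + fusion_linear u v t)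
    (fusion_polar u v s s) (fusion_polar u v s t + fusion_polar u v t s)
    (fusion_polar u v t t) p q.
Proof.
rewrite /quad /fusion_defect /fusion_polar /fusion_linear.
by rewrite !(alg_mulE, formE); lin.
Qed.

Lemma frame_idempotent {m e s t p q} : circle_frame m e s t ->
  p ^+ 2 + q ^+ 2 + 2%:R * m * p * q = 1 ->
  let c := 2%:R^-1 *: e + (p *: s + q *: t) in mul c c = c /\ f c c = 1.
Proof.
case=> ee es et ss tt st fee fes fet fss ftt fst pq1.
have fse : f s e = 0 by rewrite -es form_mulC es.
have fte : f t e = 0 by rewrite -et form_mulC et.
have fts : f t s = m / 2%:R by rewrite -es -form_mulC es.
split; rewrite ?(alg_mulE, formE) ?(alg_mulC t s) ?(alg_mulC s e)
  ?(alg_mulC t e) ?ee ?es ?et ?ss ?tt ?st ?fee ?fes ?fet ?fss ?ftt ?fst ?fts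
  ?fse ?fte.
  transitivity (((p ^+ 2 + q ^+ 2 + 2%:R * m * p * q + 1) / 4%:R) *: e
    + (p *: s + q *: t)); first by lin.
  by rewrite pq1; lin.
transitivity ((p ^+ 2 + q ^+ 2 + 2%:R * m * p * q + 1) / 2%:R).
  by scalar_field.
by rewrite pq1; scalar_field.
Qed.

Lemma frame_orbit {m e s t} : circle_frame m e s t ->
  axial_idempotent (2%:R^-1 *: e + s) -> axial_idempotent (2%:R^-1 *: e + t) ->
  axial_idempotent (2%:R^-1 *: e + ((2%:R * m) *: s - t)).
Proof.
by move=> fr axs axt; rewrite -frame_reflect //; exact: axial_miyamoto.
Qed.

Lemma axial_conic {m e s t p q} : circle_frame m e s t ->
  m != 0 -> m != 1 -> 2%:R * m + 1 != 0 ->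
  axial_idempotent (2%:R^-1 *: e + s) -> axial_idempotent (2%:R^-1 *: e + t) ->
  p ^+ 2 + q ^+ 2 + 2%:R * m * p * q = 1 ->
  axial_idempotent (2%:R^-1 *: e + (p *: s + q *: t)).
Proof.
move=> fr m0 m1 m2 axs axt pq1; set o := 2%:R^-1 *: e.
have fr' := frame_sym fr.
have ax3 := frame_orbit fr axs axt.
have ax4 := frame_orbit fr' axt axs.
(* The fifth point is the reflection of t that fixes 2mt - s. *)
have ax5 := frame_orbit (frame_coords fr') ax4 axt.
rewrite -/o in axs axt ax3 ax4 ax5.
have E1 : o + s = o + (1 *: s + 0 *: t) by lin.
have E2 : o + t = o + (0 *: s + 1 *: t) by lin.
have E3 : o + ((2%:R * m) *: s - t) = o + ((2%:R * m) *: s + (- 1) *: t) by lin.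
have E4 : o + ((2%:R * m) *: t - s) = o + ((- 1) *: s + (2%:R * m) *: t) by lin.
have E5 : o + ((2%:R * m) *: ((2%:R * m) *: t - s) - t) =
          o + ((- (2%:R * m)) *: s + (4%:R * m ^+ 2 - 1) *: t) by lin.
move: axs axt ax3 ax4 ax5; rewrite E1 E2 E3 E4 E5.
case=> _ _ P1 G1 [_ _ P2 G2] [_ _ P3 G3] [_ _ P4 G4] [_ _ P5 G5].
have [cc fcc] := frame_idempotent fr pq1.
split=> // [u|u v].
  rewrite peirce_defect_quad.
  by apply: (quad_five_points two_neq0 m) => //; rewrite -peirce_defect_quad.
rewrite fusion_defect_quad.
by apply: (quad_five_points two_neq0 m) => //; rewrite -fusion_defect_quad.
Qed.

(** * The orthogonal case m = 0 *)

(** The coefficient relations hold for all u and v. Specialising these to s, t, tu and s(tu) yields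
    rewriting rules for nested multiplications by e, s and t, which then determine the missing (p
    q)-coefficients. *)
Lemma axial_conic_orthogonal {e s t p q} : circle_frame 0 e s t ->
  axial_idempotent (2%:R^-1 *: e + s) -> axial_idempotent (2%:R^-1 *: e + t) ->
  p ^+ 2 + q ^+ 2 + 2%:R * 0 * p * q = 1 ->
  axial_idempotent (2%:R^-1 *: e + (p *: s + q *: t)).
Proof.
move=> fr axs axt pq1.
have eight_neq0 : (8%:R : F) != 0 by rewrite (natrM F 4 2) mulf_neq0.
have h16_neq0 : (16%:R : F) != 0 by rewrite (natrM F 4 4) mulf_neq0.
have h32_neq0 : (32%:R : F) != 0 by rewrite (natrM F 8 4) mulf_neq0.
(* The existential keeps the centre o = e/2 opaque for the formal expansions. *)
have [PA GA] : (forall u, exists2 o, o = 2%:R^-1 *: e &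
    [/\ peirce_polar u o s + peirce_polar u s o - mul s u = 0,
        peirce_polar u o t + peirce_polar u t o - mul t u = 0,
        peirce_polar u t t = peirce_polar u s s &
        peirce_defect o u + peirce_polar u s s = 0]) /\
  (forall u v, exists2 o, o = 2%:R^-1 *: e &
    [/\ fusion_polar u v o s + fusion_polar u v s o + fusion_linear u v s = 0,
        fusion_polar u v o t + fusion_polar u v t o + fusion_linear u v t = 0,
        fusion_polar u v t t = fusion_polar u v s s &
        fusion_defect o u v + fusion_polar u v s s = 0]).
  have fr' := frame_sym fr.
  have ax3 := frame_orbit fr axs axt.
  have ax4 := frame_orbit fr' axt axs.
  move: axs axt ax3 ax4; set o := 2%:R^-1 *: e.
  have -> : o + s = o + (1 *: s + 0 *: t) by lin.
  have -> : o + t = o + (0 *: s + 1 *: t) by lin.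
  have -> : o + ((2%:R * 0) *: s - t) = o + ((2%:R * 0) *: s + (- 1) *: t).
    by lin.
  have -> : o + ((2%:R * 0) *: t - s) = o + ((- 1) *: s + (2%:R * 0) *: t).
    by lin.
  case=> _ _ P1 G1 [_ _ P2 G2] [_ _ P3 G3] [_ _ P4 G4].
  have h1 : 0 != 1 :> F by rewrite eq_sym oner_neq0.
  have h2 : 2%:R * 0 + 1 != 0 :> F by rewrite mulr0 add0r oner_neq0.
  split=> [u|u v]; exists o => //.
    move: (P1 u) (P2 u) (P3 u) (P4 u); rewrite !peirce_defect_quad.
    move=> Q1 Q2 Q3 Q4.
    (* At m = 0 the last relation reads [R0 + R11 = 0], which turns the first two into R1 = R2 =
       0. *)
    have [-> -> ->] :=
      quad_four_points two_neq0 0 _ _ _ _ _ _ h1 h2 Q1 Q2 Q3 Q4.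
    by rewrite subr0 scale1r scale0r => ->; rewrite oppr0.
  move: (G1 u v) (G2 u v) (G3 u v) (G4 u v); rewrite !fusion_defect_quad.
  move=> Q1 Q2 Q3 Q4.
  have [-> -> ->] := quad_four_points two_neq0 0 _ _ _ _ _ _ h1 h2 Q1 Q2 Q3 Q4.
  by rewrite subr0 scale1r scale0r => ->; rewrite oppr0.
have [cc fcc] := frame_idempotent fr pq1.
have [ee es et ss tt st fee fes fet fss ftt fst] := fr.
rewrite mul0r scale0r in st; rewrite mul0r in fst.
have se : mul s e = s by rewrite alg_mulC.
have ts : mul t s = 0 by rewrite alg_mulC.
have fts : f t s = 0 by rewrite -es -form_mulC es.
have fs_tu u : f s (mul t u) = 0 by rewrite -form_assoc st form0l.
have ft_su u : f t (mul s u) = 0 by rewrite -form_assoc ts form0l.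
have fs_su u : f s (mul s u) = 4%:R^-1 * f e u by rewrite -form_assoc ss formZl.
have ft_tu u : f t (mul t u) = 4%:R^-1 * f e u by rewrite -form_assoc tt formZl.
have fe_eu u : f e (mul e u) = f e u by rewrite -form_assoc ee.
have fs_eu u : f s (mul e u) = f s u by rewrite -form_assoc se.
have fe_tu u : f e (mul t u) = f t u by rewrite -form_assoc et.
(* Equality of the p^2- and q^2-coefficients of the second identity at (u,t): the s-side vanishes
   since st = 0, and tt = e/4 produces e(tu). *)
have e_tu u : mul e (mul t u) =
    2%:R^-1 *: mul t u + (4%:R^-1 * f t u) *: e + (4%:R^-1 * f e u) *: t.
  have [_ _ [_ _ + _]] := GA u t; rewrite /fusion_polar (alg_mulC u t).
  rewrite fs_tu ft_tu st tt fst ftt !alg_mulE (alg_mulC _ e) => h.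
  by apply: (eq_lincomb1 1 h); lin.
have e_su u : mul e (mul s u) =
    2%:R^-1 *: mul s u + (4%:R^-1 * f s u) *: e + (4%:R^-1 * f e u) *: s.
  have [_ _ [_ _ + _]] := GA u s; rewrite /fusion_polar (alg_mulC u s).
  rewrite ft_su fs_su ts ss fts fss !alg_mulE (alg_mulC _ e) => h.
  by apply: (eq_lincomb1 (- 1) h); lin.
have s_eu u : mul s (mul e u) =
    2%:R^-1 *: mul s u + (4%:R^-1 * f s u) *: e + (4%:R^-1 * f e u) *: s.
  have [_ -> [+ _ _ _]] := PA u; rewrite /peirce_polar !(alg_mulE, formE) e_su.
  by move=> h; apply: (eq_lincomb1 1 h); lin.
have s_su u : mul s (mul s u) = 4%:R^-1 *: (mul e u - mul e (mul e u))
    + (2%:R^-1 * f s u) *: s + (8%:R^-1 * f e u) *: e.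
  have [_ -> [_ _ _ h]] := PA u.
  apply: (eq_lincomb1 2%:R^-1 h); rewrite /peirce_polar /peirce_defect.
  by rewrite !(alg_mulE, formE); lin.
have t_tu u : mul t (mul t u) = 4%:R^-1 *: (mul e u - mul e (mul e u))
    + (2%:R^-1 * f t u) *: t + (8%:R^-1 * f e u) *: e.
  have [_ _ [_ _ + _]] := PA u; rewrite /peirce_polar s_su => h.
  by apply: (eq_lincomb1 2%:R^-1 h); lin.
(* The (p q)-coefficient of the first identity at u is the p-coefficient of the
   second one at (u, t). *)
have st_anti u : peirce_polar u s t + peirce_polar u t s = 0.
  have [_ -> [+ _ _ _]] := GA u t.
  rewrite /peirce_polar /fusion_polar /fusion_linear !(alg_mulE, formE).
  rewrite (alg_mulC u t) st et fs_tu fst fet alg_mulE fe_tu.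
  rewrite (alg_mulC _ t) alg_mulE => h.
  by apply: (eq_lincomb1 2%:R h); lin.
(* In [st_anti] at tu, the factor t(tu) becomes a polynomial in e, and [s_eu] resolves its product
   with s. *)
have t_stu u : mul t (mul s (mul t u)) = - (16%:R^-1 *: mul s u)
    + (32%:R^-1 * f s u) *: e + (32%:R^-1 * f e u) *: s.
  have := st_anti (mul t u); rewrite /peirce_polar t_tu !alg_mulE.
  rewrite !s_eu st se fs_tu ft_tu fs_eu fe_eu => h.
  by apply: (eq_lincomb1 2%:R^-1 h); lin.
have s_stu u : mul s (mul s (mul t u)) = 16%:R^-1 *: mul t u
    + (3%:R * 32%:R^-1 * f t u) *: e - (32%:R^-1 * f e u) *: t.
  by rewrite s_su !(alg_mulE, e_tu) fs_tu fe_tu ee et; lin.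
(* The p^2- and q^2-coefficients of the second identity agree; at (s(tu), v)
   this is its (p q)-coefficient at (u, v), up to the scalar -16 and a multiple
   of the (p q)-coefficient of the first identity at v. *)
have st_fusion u v : fusion_polar u v s t + fusion_polar u v t s = 0.
  have [_ _ [_ _ + _]] := GA (mul s (mul t u)) v.
  rewrite /fusion_polar fs_su ft_su fe_tu -!form_assoc s_stu t_stu.
  rewrite !(alg_mulE, formE, form_assoc, e_su, e_tu) => h.
  apply: (eq_lincomb2 (- 16%:R) (f e u) h (st_anti v)).
  rewrite /peirce_polar; lin.
split=> // [u|u v].
  have [_ -> [R1 R2 R22 R0]] := PA u.
  rewrite peirce_defect_quad (quad_conic 0) //; first last.
  - by rewrite R2 R0 oppr0.
  - by rewrite R1 R0 oppr0.
  by rewrite R0 st_anti mulr0 scale0r subr0 !scaler0 addr0.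
have [_ -> [R1 R2 R22 R0]] := GA u v.
rewrite fusion_defect_quad (quad_conic 0) //; first last.
- by rewrite R2 R0 oppr0.
- by rewrite R1 R0 oppr0.
by rewrite R0 st_fusion mulr0 scale0r subr0 !scaler0 addr0.
Qed.

(** * Idempotents of the span of a frame *)

Definition frame_span (e s t u : A) : Prop :=
  exists z p q, u = z *: e + (p *: s + q *: t).

Lemma frame_span_closed {m e s t} :
  circle_frame m e s t -> Defs.subalg_closed mul (frame_span e s t).
Proof.
case=> ee es et ss tt st *.
split=> [|k _ _ [z [p [q ->]]] [z' [p' [q' ->]]]
        |_ _ [z [p [q ->]]] [z' [p' [q' ->]]]].
- by exists 0, 0, 0; rewrite !scale0r !addr0.
- by exists (k * z + z'), (k * p + p'), (k * q + q'); lin.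
exists (z * z' + 4%:R^-1 * (p * p' + q * q' + m * (p * q' + q * p'))),
  (z * p' + p * z'), (z * q' + q * z').
rewrite !alg_mulE (alg_mulC s e) (alg_mulC t e) (alg_mulC t s).
by rewrite ee es et ss tt st; lin.
Qed.

(** Coefficients are compared by pairing cc = c with e, s and t; the Gram matrix of s and t is
    invertible because m^2 != 1. Hence 2z = 1 or p = q = 0. *)
Lemma frame_idempotents {m e s t z p q} : circle_frame m e s t ->
  m != 1 -> m != - 1 ->
  let c := z *: e + (p *: s + q *: t) in
  mul c c = c ->
  [\/ c = 0, c = e |
      z = 2%:R^-1 /\ p ^+ 2 + q ^+ 2 + 2%:R * m * p * q = 1].
Proof.
case=> ee es et ss tt st fee fes fet fss ftt fst m1 m2 c.
have fse : f s e = 0 by rewrite -es form_mulC es.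
have fte : f t e = 0 by rewrite -et form_mulC et.
have fts : f t s = m / 2%:R by rewrite -es -form_mulC es.
pose n := p ^+ 2 + q ^+ 2 + 2%:R * m * p * q.
have -> : mul c c = (z ^+ 2 + n / 4%:R) *: e
                    + ((2%:R * z * p) *: s + (2%:R * z * q) *: t).
  rewrite /c !alg_mulE (alg_mulC s e) (alg_mulC t e) (alg_mulC t s).
  by rewrite ee es et ss tt st /n; lin.
move=> cc; have fcc w := congr1 (f w) cc; rewrite /c in fcc.
move: (fcc e) (fcc s) (fcc t).
rewrite !formE fee fes fet fss ftt fst fse fte fts.
move=> ce cs ct.
have ds : (2%:R * z - 1) * (p + m * q) = 0.
  move/(congr1 ( *%R 2%:R)): cs => cs; rewrite mulrBl mul1r.
  apply/eqP; rewrite subr_eq0; apply/eqP.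
  by apply: etrans (etrans _ cs) _; scalar_field.
have dt : (2%:R * z - 1) * (m * p + q) = 0.
  move/(congr1 ( *%R 2%:R)): ct => ct; rewrite mulrBl mul1r.
  apply/eqP; rewrite subr_eq0; apply/eqP.
  by apply: etrans (etrans _ ct) _; scalar_field.
(* Eliminating q gives the factor 1 - m^2, written so that [subr_eq0] meets the hypotheses on m. *)
have dp : (2%:R * z - 1) * ((1 - m) * (m - - 1)) * p = 0.
  transitivity ((2%:R * z - 1) * (p + m * q)
                - m * ((2%:R * z - 1) * (m * p + q))); first by ring.
  by rewrite ds dt mulr0 subr0.
have dq : (2%:R * z - 1) * ((1 - m) * (m - - 1)) * q = 0.
  transitivity ((2%:R * z - 1) * (m * p + q)
                - m * ((2%:R * z - 1) * (p + m * q))); first by ring.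
  by rewrite ds dt mulr0 subr0.
have nE : n = 4%:R * (z - z ^+ 2).
  have h : z ^+ 2 + n / 4%:R = z.
    by apply: (mulIf two_neq0); move: ce; rewrite !mulr0 !addr0.
  by rewrite -{1}h; scalar_field.
have [z2|z2] := eqVneq (2%:R * z - 1) 0.
  have zE : z = 2%:R^-1.
    apply: (mulfI two_neq0); rewrite divff //.
    by apply/eqP; rewrite -subr_eq0 z2.
  by apply: Or33; split=> //; rewrite -/n nE zE; scalar_field.
have mm : (1 - m) * (m - - 1) != 0.
  by rewrite mulf_neq0 // subr_eq0 // eq_sym.
have p0 : p = 0 by apply: (mulfI (mulf_neq0 z2 mm)); rewrite mulr0.
have q0 : q = 0 by apply: (mulfI (mulf_neq0 z2 mm)); rewrite mulr0.
have : z * (1 - z) = 0.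
  apply: (mulfI four_neq0); rewrite mulr0 -[RHS](_ : n = 0); last first.
    by rewrite /n p0 q0; ring.
  by rewrite nE; ring.
move/eqP; rewrite mulf_eq0 subr_eq0 => /orP[/eqP z0|/eqP z1].
  by apply: Or31; rewrite /c p0 q0 z0 !scale0r !addr0.
by apply: Or32; rewrite /c p0 q0 -z1 !scale0r !addr0 scale1r.
Qed.

End FrobeniusAlgebra.

(** * Solidity of the subalgebra generated by a and b *)

Theorem theorem1 (F : fieldType) (A : lmodType F) (mul : A -> A -> A)
    (f : A -> A -> F) (a b : A) :
  (2%:R : F) != 0 ->
  jordan_half_algebra mul ->
  frobenius_form mul f ->
  primitive_axis mul a -> primitive_axis mul b ->
  f a b <> 0 -> f a b <> (4%:R)^-1 -> f a b <> 1 ->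
  solid mul (gen mul (fun u => u = a \/ u = b)).
Proof.
move=> two_neq0 [algA _] frobf axisa axisb k0 k4 k1.
have four_neq0 : (4%:R : F) != 0 by rewrite (natrM F 2 2) mulf_neq0.
have axa := axial_of_primitive two_neq0 algA frobf axisa.
have axb := axial_of_primitive two_neq0 algA frobf axisb.
have /eqP k1' := k1.
have [e fr] := circle_frame_axes two_neq0 algA frobf k1' axa axb.
move: fr; set k := f a b in k0 k4 k1 k1' *; set m := 2%:R * k - 1.
set s := a - _; set t := b - _ => fr.
(* The excluded values 1, 0 and 1/4 of (a,b) become m = 1, -1 and -1/2. *)
have m1 : m != 1.
  apply/eqP => mE; apply: k1; apply: (mulfI two_neq0).
  by rewrite -[LHS](subrK 1) -/m mE; ring.
have m1' : m != - 1.
  apply/eqP => mE; apply: k0; apply: (mulfI two_neq0).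
  by rewrite -[LHS](subrK 1) -/m mE; ring.
have m2 : 2%:R * m + 1 != 0.
  apply/eqP => mE; apply: k4; apply: (mulfI four_neq0); rewrite divff //.
  transitivity (2%:R * m + 1 + 1); first by rewrite /m; ring.
  by rewrite mE add0r.
have aE : a = 2%:R^-1 *: e + s by rewrite /s; lin.
have bE : b = 2%:R^-1 *: e + t by rewrite /t; lin.
clearbody s t.
have Jspan u : gen mul (fun u => u = a \/ u = b) u -> frame_span e s t u.
  apply=> [|_ [->|->]]; first exact: (frame_span_closed two_neq0 algA fr).
    by exists 2%:R^-1, 1, 0; rewrite [LHS]aE; lin.
  by exists 2%:R^-1, 0, 1; rewrite [LHS]bE; lin.
move=> c /Jspan [z [p [q cE]]] cc c0 cN1; rewrite cE in cc c0 cN1 *.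
apply: (primitive_of_axial two_neq0 algA frobf).
have axs : axial_idempotent (mul := mul) (f := f) (2%:R^-1 *: e + s).
  by rewrite -aE.
have axt : axial_idempotent (mul := mul) (f := f) (2%:R^-1 *: e + t).
  by rewrite -bE.
case: (frame_idempotents two_neq0 algA frobf fr m1 m1' cc).
- by move/c0.
(* The element e is an identity on the whole span, which contains J. *)
- move=> cE'; case: cN1 => u /Jspan [z' [p' [q' ->]]]; rewrite cE'.
  have [ee es et _ _ _ _ _ _ _ _ _] := fr.
  by rewrite !(alg_mulE algA) ee es et.
move=> [-> pq1]; have [m0|m0] := eqVneq m 0.
  move: fr pq1; rewrite m0 => fr pq1.
  exact: (axial_conic_orthogonal two_neq0 algA frobf).
exact: (axial_conic two_neq0 algA frobf) m0 m1 m2 axs axt pq1.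
Qed.
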